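(* Let $\mathbf{k}$ be a field, let $A=\mathbf{k}((t))$ be the complete discrete valuation field of formal Laurent series, with valuation ring $\mathcal{O}=\mathbf{k}[[t]]$. For every $n$, the number of $GL_n(A)$-orbits in $\mathcal{G}_n(\mathcal{O})$ is finite.
   Context: $\mathcal{G}_n(\mathcal{O})$ denotes the set of all $\mathcal{O}$-submodules (not necessarily finitely generated) of $A^n$. The group $GL_n(A)$ acts on it by $g\cdot M=g(M)$. *)

(* Defs.v *)
From HB Require Import structures.
From mathcomp Require Import all_boot all_order all_algebra.
From mathcomp Require Import all_classical.
Set Implicit Arguments.
Unset Strict Implicit.
Unset Printing Implicit Defensive.
Import Order.TTheory GRing.Theory Num.Theory.
Local Open Scope classical_set_scope.
Local Open Scope ring_scope.

Section Laurent.
Variable k : fieldType.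
Implicit Types (f g : int -> k) (a b c d m : int).

Definition zero_below f a := forall i : int, i < a -> f i = 0.

Definition laurent_pred : {pred (int -> k)} :=
  fun f => `[< exists a, zero_below f a >].

Lemma laurent_predP f :
  reflect (exists a, zero_below f a) (f \in laurent_pred).
Proof. exact: asboolP. Qed.

Fact laurent_zmod_closed : zmod_closed laurent_pred.
Proof.
split; first by apply/laurent_predP; exists 0.
move=> f g /laurent_predP[a fa] /laurent_predP[b gb].
apply/laurent_predP; exists (Num.min a b) => i.
rewrite lt_min => /andP[ia ib].
by rewrite -[LHS]/(f i - g i) fa// gb// subr0.
Qed.

HB.instance Definition _ :=
  GRing.isZmodClosed.Build (int -> k) laurent_pred laurent_zmod_closed.

(* k((t)): a series is its coefficient function int -> k, which vanishes at all
   sufficiently negative exponents. *)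
Record laurent := Laurent {
  lcoef :> int -> k;
  _ : lcoef \in laurent_pred }.

HB.instance Definition _ := [isSub for lcoef].
HB.instance Definition _ := [Choice of laurent by <:].
HB.instance Definition _ := [SubChoice_isSubZmodule of laurent by <:].

Implicit Types x y z : laurent.

Lemma laurentP x y : (forall i, x i = y i) -> x = y.
Proof. by move=> xy; apply/val_inj/funext. Qed.

Lemma lcoef0 i : (0 : laurent) i = 0. Proof. by []. Qed.
Lemma lcoefD x y i : (x + y) i = x i + y i. Proof. by []. Qed.
Lemma lcoefN x i : (- x) i = - x i. Proof. by []. Qed.

Lemma laurent_bound x : exists a, zero_below x a.
Proof. exact/laurent_predP/(valP x). Qed.

(* The sum over all of int has finitely many nonzero terms when f and g are
   Laurent series (see conv_coef); fsbigop is 0 on infinite supports. *)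
Definition conv f g m : k := \sum_(i \in [set: int]) f i * g (m - i).

Lemma int_below a m : a <= m -> exists n : nat, m = a + n%:Z.
Proof.
rewrite -subr_ge0; case E: (m - a) => [n|//] _; exists n.
by rewrite -E addrC subrK.
Qed.

Lemma conv_coef f g a b (n : nat) : zero_below f a -> zero_below g b ->
  conv f g (a + b + n%:Z) =
  \sum_(i < n.+1) f (a + i%:Z) * g (b + (n - i)%N%:Z).
Proof.
move=> fa gb; rewrite /conv.
pose h (i : nat) : int := a + i%:Z.
pose r := map h (iota 0 n.+1).
rewrite (fsbigE r); first last.
- move=> i _ iN; case: (ltP i a) => [/fa->|ai]; first by rewrite mul0r.
  rewrite gb ?mulr0//.
  have [p ip] := int_below ai.
  move: iN; rewrite ip => iN; rewrite opprD addrACA addrA [a + b]addrC addrK.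
  rewrite -addrA gtrDl subr_lt0 ltz_nat ltnNge; apply: contra iN => pn.
  by rewrite (map_f h (_ : p \in iota 0 n.+1))// mem_iota.
- by [].
- by rewrite map_inj_uniq ?iota_uniq// => p q /addrI[].
rewrite big_map -[iota 0 n.+1]/(index_iota 0 n.+1) big_mkord.
apply: eq_big => [i|i _]; first by rewrite in_setT.
rewrite opprD addrACA addrA [a + b]addrC addrK -addrA subzn// -ltnS.
exact: ltn_ord.
Qed.

Lemma conv_below f g a b : zero_below f a -> zero_below g b ->
  zero_below (conv f g) (a + b).
Proof.
move=> fa gb m mab; rewrite /conv fsbig1// => i _.
case: (ltP i a) => [/fa->|ai]; first by rewrite mul0r.
by rewrite gb ?mulr0// ltrBlDr (lt_le_trans mab)// [b + i]addrC lerD2r.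
Qed.

Fact conv_laurent x y : conv x y \in laurent_pred.
Proof.
have [a xa] := laurent_bound x; have [b yb] := laurent_bound y.
by apply/laurent_predP; exists (a + b); apply: conv_below.
Qed.

Definition lmul x y := Laurent (conv_laurent x y).

(* The monomial t^a; in particular lX 0 is the constant series 1. *)
Fact lX_laurent a : (fun i => (i == a)%:R : k) \in laurent_pred.
Proof. by apply/laurent_predP; exists a => i ia; rewrite lt_eqF. Qed.

Definition lX a := Laurent (lX_laurent a).

Definition window f a n : {poly k} := \poly_(i < n) f (a + i%:Z).

Lemma window_mul x y a b (n N : nat) : zero_below x a -> zero_below y b ->
  (n < N)%N ->
  lmul x y (a + b + n%:Z) = (window x a N * window y b N)`_n.
Proof.
move=> xa yb nN; rewrite [LHS](conv_coef n xa yb) coefM; apply: eq_bigr => i _.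
have iN : (i < N)%N by apply: leq_ltn_trans nN; rewrite -ltnS.
by rewrite !coef_poly iN (leq_ltn_trans (leq_subr _ _) nN).
Qed.

Lemma lmul_below x y a b : zero_below x a -> zero_below y b ->
  zero_below (lmul x y) (a + b).
Proof. exact: conv_below. Qed.

Fact lmulC : commutative lmul.
Proof.
move=> x y; apply: laurentP => m.
have [a xa] := laurent_bound x; have [b yb] := laurent_bound y.
have xy := lmul_below xa yb; have yx := lmul_below yb xa.
have [mab|/int_below[n ->]] := ltP m (a + b).
  by rewrite xy// yx// addrC.
rewrite (window_mul xa yb (ltnSn n)) mulrC.
by rewrite -(window_mul yb xa (ltnSn n)) [b + a]addrC.
Qed.

Fact lmulA : associative lmul.
Proof.
move=> x y z; apply: laurentP => m.
have [a xa] := laurent_bound x; have [b yb] := laurent_bound y.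
have [c zc] := laurent_bound z.
have xy := lmul_below xa yb; have yz := lmul_below yb zc.
have [mabc|/int_below[n ->]] := ltP m (a + b + c).
  by rewrite (lmul_below xy zc)// (lmul_below xa yz)// addrA.
rewrite (window_mul xy zc (ltnSn n)) -[X in lmul x _ X]/(_ + _ + _) -[a + b + c]addrA.
rewrite (window_mul xa yz (ltnSn n)).
have -> : (window x a n.+1 * window (lmul y z) (b + c) n.+1)`_n =
          (window x a n.+1 * (window y b n.+1 * window z c n.+1))`_n.
  rewrite !coefM; apply: eq_bigr => i _; congr (_ * _).
  by rewrite coef_poly ltnS leq_subr (@window_mul _ _ _ _ _ n.+1)// ltnS leq_subr.
rewrite mulrA !coefM; apply: eq_bigr => i _; congr (_ * _).
by rewrite coef_poly ltn_ord (@window_mul _ _ _ _ _ n.+1).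
Qed.

Lemma lX_below a : zero_below (lX a) a.
Proof. by move=> i ia /=; rewrite lt_eqF. Qed.

Lemma lmulX a x m : lmul (lX a) x m = x (m - a).
Proof.
rewrite /= /conv (fsbigE [:: a]) //=; last first.
  by move=> i _; rewrite inE => /negbTE ia; rewrite ia mul0r.
by rewrite big_cons big_nil in_setT eqxx mul1r addr0.
Qed.

Fact lmul1 : left_id (lX 0) lmul.
Proof. by move=> x; apply: laurentP => m; rewrite lmulX subr0. Qed.

Fact lmulDl : left_distributive lmul +%R.
Proof.
move=> x y z; apply: laurentP => m.
have [a xa] := laurent_bound x; have [b yb] := laurent_bound y.
have [c zc] := laurent_bound z.
pose d := Num.min a b.
have xd : zero_below x d by move=> i; rewrite lt_min => /andP[/xa].
have yd : zero_below y d by move=> i; rewrite lt_min => /andP[_ /yb].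
have xyd : zero_below (x + y) d by move=> i id; rewrite lcoefD xd ?yd ?addr0.
rewrite lcoefD; have [mdc|/int_below[n ->]] := ltP m (d + c).
  by rewrite (lmul_below xyd zc)// (lmul_below xd zc)// (lmul_below yd zc)// addr0.
rewrite /= !(conv_coef n _ zc)// -big_split; apply: eq_bigr => i _ /=.
by rewrite -mulrDl.
Qed.

Fact lone_neq0 : lX 0 != 0.
Proof.
apply/eqP => /(congr1 (fun x : laurent => x 0)) /= /eqP.
by rewrite oner_eq0.
Qed.

HB.instance Definition _ := GRing.Zmodule_isComNzRing.Build laurent
  lmulA lmulC lmul1 lmulDl lone_neq0.

Lemma lcoefM x y m : (x * y) m = \sum_(i \in [set: int]) x i * y (m - i).
Proof. by []. Qed.

Lemma lcoef1 i : (1 : laurent) i = (i == 0)%:R.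
Proof. by []. Qed.

(* Coefficients of the inverse of a power series with coefficients F, when
   F 0 != 0. *)
Fixpoint psinv_seq (F : nat -> k) (n : nat) : seq k :=
  if n is p.+1 then
    let s := psinv_seq F p in
    rcons s ((F 0)^-1 * ((p == 0)%:R - \sum_(i < p) F (p - i)%N * s`_i))
  else [::].

Definition psinv F n := (psinv_seq F n.+1)`_n.

Lemma size_psinv_seq F n : size (psinv_seq F n) = n.
Proof. by elim: n => //= n IHn; rewrite size_rcons IHn. Qed.

Lemma nth_psinv_seq F n i : (i < n)%N -> (psinv_seq F n)`_i = psinv F i.
Proof.
elim: n => // n IHn; rewrite ltnS leq_eqVlt => /orP[/eqP->//|lt_in].
by rewrite /= nth_rcons size_psinv_seq lt_in IHn.
Qed.

Lemma psinvP F n : F 0 != 0 ->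
  \sum_(i < n.+1) psinv F i * F (n - i)%N = (n == 0)%:R.
Proof.
move=> F0; rewrite big_ord_recr /= subnn {2}/psinv /= nth_rcons size_psinv_seq.
rewrite ltnn eqxx mulrC mulrA mulfV// mul1r addrC.
rewrite [X in _ + X](eq_bigr (fun i : 'I_n =>
  F (n - i)%N * (psinv_seq F n)`_i)) ?subrK//.
by move=> i _; rewrite nth_psinv_seq// mulrC.
Qed.

Lemma laurent_lead x : x != 0 -> exists2 a, zero_below x a & x a != 0.
Proof.
move=> x0; have [b xb] := laurent_bound x.
have exn : exists n : nat, x (b + n%:Z) != 0.
  apply: contrapT => /forallNP nx; case/eqP: x0; apply: laurentP => m.
  have [/xb//|/int_below[n ->]] := ltP m b.
  by have /negP := nx n; rewrite negbK => /eqP.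
case: (ex_minnP exn) => n xn nmin; exists (b + n%:Z) => // m mn.
have [/xb//|/int_below[p mE]] := ltP m b.
apply/eqP; apply: contraTT mn => xm.
by rewrite -leNgt mE lerD2l lez_nat nmin// -mE.
Qed.

Lemma laurent_inv_ex x : exists y, x != 0 -> y * x = 1.
Proof.
have [->|x0] := eqVneq x 0; first by exists 0.
have [a xa xa0] := laurent_lead x0.
pose F n := x (a + n%:Z).
pose g (m : int) : k := if m < - a then 0 else psinv F (absz (m + a)).
have gl : g \in laurent_pred.
  by apply/laurent_predP; exists (- a) => i ia; rewrite /g ia.
exists (Laurent gl) => _.
have ga : zero_below (Laurent gl) (- a) by move=> i ia; rewrite /= /g ia.
apply: laurentP => m; rewrite lcoef1.
have [m0|/int_below[n ->]] := ltP m 0.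
  by rewrite (lmul_below ga xa) ?addNr// lt_eqF.
rewrite -{1}(addNr a) [LHS](conv_coef n ga xa) add0r.
rewrite -[RHS]/((n == 0)%:R) -(@psinvP F) ?/F ?addr0//.
apply: eq_bigr => i _; congr (_ * _).
by rewrite /= /g ltNge lerDl /= addrAC addNr add0r.
Qed.

Definition linv x : laurent :=
  if x == 0 then 0 else projT1 (cid (laurent_inv_ex x)).

Fact lmulVf x : x != 0 -> linv x * x = 1.
Proof. by move=> x0; rewrite /linv ifN//; case: cid => y /= ->. Qed.

Fact linv0 : linv 0 = 0. Proof. by rewrite /linv ifT. Qed.

HB.instance Definition _ := GRing.ComNzRing_isField.Build laurent lmulVf linv0.

(* k[[t]], as a subring of k((t)). *)
Definition valuation_ring : {pred laurent} := fun x => `[< zero_below x 0 >].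

Fact valuation_ring_subring_closed : subring_closed valuation_ring.
Proof.
split=> [|x y /asboolP x0 /asboolP y0|x y /asboolP x0 /asboolP y0].
- by apply/asboolP; exact: lX_below.
- by apply/asboolP => i i0; rewrite lcoefD lcoefN x0// y0// subr0.
- by apply/asboolP; rewrite -[0]addr0; exact: lmul_below.
Qed.

HB.instance Definition _ := GRing.isSubringClosed.Build laurent valuation_ring
  valuation_ring_subring_closed.

End Laurent.

Section Orbits.
Variables (k : fieldType) (n : nat).
Local Notation A := (laurent k).
Local Notation O := (@valuation_ring k).
Implicit Type M : set 'cV[A]_n.

Definition is_submodule M :=
  [/\ M 0, (forall u v, M u -> M v -> M (u + v)) &
      (forall a u, a \in O -> M u -> M (a *: u))].

Definition submodules : set (set 'cV[A]_n) := [set M | is_submodule M].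

Definition GL : set 'M[A]_n := [set g | g \in unitmx].

Definition act (g : 'M[A]_n) M : set 'cV[A]_n := [set g *m v | v in M].

Definition orbit M : set (set 'cV[A]_n) := [set act g M | g in GL].

Definition orbits : set (set (set 'cV[A]_n)) :=
  [set orbit M | M in submodules].

End Orbits.

Arguments submodules : clear implicits.
Arguments GL : clear implicits.
Arguments orbits : clear implicits.

(* Main.v *)
Require Import Defs.
From mathcomp Require Import all_boot all_order all_algebra.
From mathcomp Require Import all_classical.

(** Write A for k((t)) and O for k[[t]]. Every O-submodule of A^n is moved by
    some element of GL_n(A) onto a standard one, a product S_1 x ... x S_n whose
    factors are each 0, O or A. There are 3^n standard submodules, hence at most
    3^n orbits.

    The reduction to standard form is by induction on n, projecting a submodule
    M of A x A^n to its first coordinate. The kernel M' of this projection is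
    standard up to GL_n(A), by induction. The image is an O-submodule of A,
    hence 0, t^a O or A ([ideal_trichotomy]). If the projection onto the image
    splits, then M is M' plus O v or A v for one vector v, and completing v to a
    basis gives the matrix sought ([pivot], [std_step]). A splitting is
    immediate when the image is 0 or t^a O. When the image is A, the question is
    whether M contains a whole line A v that projects onto A, and this is where
    the completeness of k((t)) enters: one lifts every t^-i to some
    t^-i (1, x_i) in M, so that x_(i+1) - x_i lies in t^i M', and a vector y with
    y - x_i in t^i M' for all i makes the line through (1, y) lie in M. Such a y
    exists coordinatewise for standard submodules ([std1_complete]), and the
    property is invariant under GL_n(A) ([act_complete]). *)

Set Implicit Arguments.
Unset Strict Implicit.
Unset Printing Implicit Defensive.
Import Order.TTheory GRing.Theory Num.Theory.
Local Open Scope classical_set_scope.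
Local Open Scope ring_scope.

(** * Monomials and leading terms of Laurent series *)

Section Series.
Variable k : fieldType.
Local Notation A := (laurent k).
Local Notation O := (@valuation_ring k).
Local Notation t := (@lX k).

Lemma coef_lXM a (x : A) m : (t a * x) m = x (m - a).
Proof. exact: lmulX. Qed.

Lemma lXD a b : t (a + b) = t a * t b.
Proof.
apply: laurentP => m; rewrite coef_lXM /=.
by rewrite [a + b]addrC -subr_eq.
Qed.

Lemma lXNK a : t (- a) * t a = 1.
Proof. by rewrite -lXD addNr. Qed.

Lemma lXKN a : t a * t (- a) = 1.
Proof. by rewrite -lXD subrr. Qed.

Lemma lX_neq0 a : t a != 0.
Proof.
by apply/eqP => ta0; move/eqP: (lXNK a); rewrite ta0 mulr0 eq_sym oner_eq0.
Qed.

Lemma lXM_valuation_ring a (x : A) : zero_below x a <-> t (- a) * x \in O.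
Proof.
split=> [xa|/asboolP xa].
  by apply/asboolP => m m0; rewrite coef_lXM opprK xa// gtrDr.
by move=> m ma; have := xa (m - a); rewrite coef_lXM opprK subrK subr_lt0; apply.
Qed.

Lemma lX_valuation_ring a : 0 <= a -> t a \in O.
Proof.
by move=> a0; apply/asboolP => m m0; apply: lX_below; apply: lt_le_trans a0.
Qed.

(** The coefficient of the product at the sum of the two leading exponents is
    the product of the leading coefficients, so it is nonzero; as the product is
    1, the leading exponents are opposite. *)
Lemma lead_inv (x : A) a :
  zero_below x a -> x a != 0 -> zero_below (x^-1)%R (- a).
Proof.
move=> xa xa0; have x0 : x != 0 by apply: contraNneq xa0 => ->.
have [b xb xb0] := laurent_lead (invr_neq0 x0).
suff ab : a + b = 0 by rewrite -[- a]addr0 -ab addKr.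
apply/eqP; have := conv_coef 0 xa xb.
rewrite big_ord1 !addr0 => xxV.
have : (x * x^-1) (a + b) != 0.
  by rewrite [X in X != _]xxV mulf_neq0.
by rewrite divff// lcoef1; case: (a + b == 0); rewrite ?eqxx.
Qed.

End Series.

(** * Submodules of the field of Laurent series *)

Section Submodules.
Variable k : fieldType.
Local Notation A := (laurent k).
Local Notation O := (@valuation_ring k).
Local Notation t := (@lX k).

(** An O-submodule I contains t^a as soon as it contains some series with
    leading exponent a, so it is determined by the upward closed set of integers
    a with t^a in I; such a set is empty, has a least element, or is everything. *)
Lemma ideal_trichotomy (I : set A) :
    I 0 -> (forall a x, a \in O -> I x -> I (a * x)) ->
  [\/ forall x, I x -> x = 0,
      exists2 a, I (t a) & forall x, I x -> t (- a) * x \in O |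
      forall a, I (t a)].
Proof.
move=> I0 IO.
have [Iz|/existsNP[x /not_implyP[Ix /eqP x0]]] :=
  pselect (forall x, I x -> x = 0).
  by constructor 1.
have lead y a : I y -> zero_below y a -> y a != 0 -> I (t a).
  move=> Iy ya ya0; have y0 : y != 0 by apply: contraNneq ya0 => ->.
  rewrite -[t a](divfK y0); apply: IO => //.
  by have /lXM_valuation_ring := lead_inv ya ya0; rewrite opprK.
have up a b : a <= b -> I (t a) -> I (t b).
  move=> ab Ia; rewrite -[b](subrK a) lXD; apply: IO => //.
  by rewrite lX_valuation_ring// subr_ge0.
have [Iall|/existsNP[b Ib]] := pselect (forall a, I (t a)).
  by constructor 3.
constructor 2.
have [c xc xc0] := laurent_lead x0; have Ic := lead _ _ Ix xc xc0.
have bc : b <= c by rewrite leNgt; apply/negP => /ltW cb; apply: Ib; apply: up Ic.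
have exn : exists n : nat, `[< I (t (b + n%:Z)) >].
  by have [n cE] := int_below bc; exists n; apply/asboolP; rewrite -cE.
case: (ex_minnP exn) => n /asboolP In nmin; exists (b + n%:Z) => // y Iy.
have [->|y0] := eqVneq y 0; first by rewrite mulr0 rpred0.
have [d yd yd0] := laurent_lead y0; have Id := lead _ _ Iy yd yd0.
apply/lXM_valuation_ring => m mn; apply: yd; apply: lt_le_trans mn _.
have bd : b <= d by rewrite leNgt; apply/negP => /ltW db; apply: Ib; apply: up Id.
have [p dE] := int_below bd.
by rewrite dE lerD2l lez_nat nmin//; apply/asboolP; rewrite -dE.
Qed.

(** * Standard submodules and completeness *)

(** The three isomorphism types of factors: [None] for 0, [Some false] for the
    valuation ring, [Some true] for the whole field. *)
Definition std1 (s : option bool) : set A :=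
  match s with
  | None => [set 0]
  | Some false => [set x | x \in O]
  | Some true => setT
  end.

Definition std n (c : 'I_n -> option bool) : set 'cV[A]_n :=
  [set v | forall i, std1 (c i) (v i 0)].

(** Sequences that are Cauchy for the filtration of the ambient space by the
    t^i M have a limit with the corresponding rate of convergence. The limit is
    determined only modulo the intersection of the t^i M, so the condition is
    void when M is a linear subspace over the field of Laurent series. *)
Definition t_complete n (M : set 'cV[A]_n) :=
  forall x : nat -> 'cV[A]_n,
    (forall i : nat, M (t (- i%:Z) *: (x i.+1 - x i))) ->
  exists y, forall i : nat, M (t (- i%:Z) *: (y - x i)).

(** For the valuation ring, the m-th coefficient of x_i is the same for all
    i > m, and these stable values are the coefficients of the limit. For 0 the
    sequence is constant, and for the whole field there is no condition. *)
Lemma std1_complete s (x : nat -> A) :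
    (forall i : nat, std1 s (t (- i%:Z) * (x i.+1 - x i))) ->
  exists y, forall i : nat, std1 s (t (- i%:Z) * (y - x i)).
Proof.
case: s => [[]|] /= xs; first by exists 0.
- have stab i j m : (i <= j)%N -> m < i%:Z -> x j m = x i m.
    move=> /subnK <- mi; elim: (j - i)%N => // p IHp.
    rewrite addSn -IHp; apply/eqP; rewrite -subr_eq0 -lcoefN -lcoefD.
    have /lXM_valuation_ring -> // := xs (p + i)%N.
    by apply: lt_le_trans mi _; rewrite lez_nat leq_addl.
  (* |m| + 1 is a natural number larger than m, so m is stable from there on. *)
  pose y m := x (absz m).+1 m.
  have yE i m : m < i%:Z -> y m = x i m.
    move=> mi; have mm : m < (absz m).+1%:Z.
      by apply: le_lt_trans (_ : (absz m)%:Z < _); rewrite ?lez_abs ?ltz_nat.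
    by rewrite /y; have [/stab->|/ltnW/stab->] := leqP i (absz m).+1.
  have [a xa] := laurent_bound (x 0).
  have yl : y \in @laurent_pred k.
    apply/laurent_predP; exists (Num.min a 0) => m.
    by rewrite lt_min => /andP[ma m0]; rewrite (yE 0) ?xa.
  exists (Laurent yl) => i; apply/lXM_valuation_ring => m mi.
  by rewrite lcoefD lcoefN /= (yE i)// subrr.
- exists (x 0) => i; suff -> : x i = x 0 by rewrite subrr mulr0.
  elim: i => // i <-; apply/eqP; rewrite -subr_eq0.
  by move/eqP: (xs i); rewrite mulf_eq0 (negbTE (lX_neq0 _ _)).
Qed.

Lemma std_complete n (c : 'I_n -> option bool) : t_complete (std c).
Proof.
move=> x xs.
have /choice[y yP] : forall j, exists y, forall i : nat,
    std1 (c j) (t (- i%:Z) * (y - x i j 0)).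
  move=> j; apply: std1_complete => i.
  by have := xs i j; rewrite !mxE.
by exists (\col_j y j) => i j; rewrite !mxE.
Qed.

Lemma act_complete n (g : 'M[A]_n) M :
  g \in unitmx -> t_complete M -> t_complete (act g M).
Proof.
move=> gu MC x xs; have [i|y yP] := MC (fun i => invmx g *m x i).
  have [v Mv vE] := xs i.
  by rewrite -mulmxBr scalemxAr -vE mulKmx.
exists (g *m y) => i; exists (t (- i%:Z) *: (y - invmx g *m x i)) => //.
by rewrite -scalemxAr mulmxBr mulKVmx.
Qed.

(** * Reduction to standard form *)

Definition type_cons n s (c : 'I_n -> option bool) (i : 'I_(1 + n)) :=
  match fintype.split i with inl _ => s | inr j => c j end.

Lemma std_cons n s (c : 'I_n -> option bool) b w :
  std (type_cons s c) (col_mx b%:M w) <-> std1 s b /\ std c w.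
Proof.
rewrite /type_cons; split=> [H|[sb cw] i].
  split=> [|j].
    by have := H (lshift n 0); rewrite (unsplitK (inl 0)) col_mxEu mxE eqxx.
  by have := H (rshift 1 j); rewrite (unsplitK (inr j)) col_mxEd.
by rewrite mxE; case: fintype.split => j; rewrite ?ord1 ?mxE ?eqxx.
Qed.

(** The vector (a, u) splits off the first coordinate: M contains its multiples
    by the factor of type s, and these already have all the first coordinates
    that occur in M. Hence M is their sum with the kernel of the first
    coordinate. *)
Lemma pivot n (M : set 'cV[A]_(1 + n)) :
    is_submodule M -> t_complete [set w : 'cV_n | M (col_mx 0 w)] ->
  exists s a u, [/\ a != 0, forall b, std1 s b -> M (b *: col_mx a%:M u) &
    forall v w, M (col_mx v%:M w) -> std1 s (v / a)].
Proof.
move=> [M0 MD MZ] Mcomplete.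
have [|a v aO [w Mw]|I0|[a [u Mu] Ia]|IA] :=
  @ideal_trichotomy [set v | exists w, M (col_mx v%:M w)].
- by exists 0; rewrite raddf0 col_mx0.
- by exists (a *: w); rewrite -scale_scalar_mx -scale_col_mx; apply: MZ.
- exists None, 1, 0; split; first exact: oner_neq0.
    by move=> b ->; rewrite scale0r.
  by move=> v w Mv /=; rewrite divr1; apply: I0; exists w.
- exists (Some false), (t a), u; split; first exact: lX_neq0.
    by move=> b bO; apply: MZ.
  move=> v w Mv /=; have -> : (t a)^-1 = t (- a).
    by rewrite -[RHS](mulfK (lX_neq0 k a)) lXNK mul1r.
  by rewrite mulrC Ia//; exists w.
have MN v : M v -> M (- v).
  by move=> Mv; rewrite -scaleN1r; apply: MZ => //; rewrite rpredN rpred1.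
have /choice[x Mx] : forall i : nat, exists w, M (t (- i%:Z) *: col_mx 1%:M w).
  move=> i; have [w Mw] := IA (- i%:Z); exists (t i%:Z *: w).
  by rewrite scale_col_mx scalerA lXNK scale1r scale_scalar_mx mulr1.
have [i|y My] := Mcomplete x.
  rewrite /mkset.
  have -> : col_mx 0 (t (- i%:Z) *: (x i.+1 - x i)) =
      t 1 *: (t (- i.+1%:Z) *: col_mx 1%:M (x i.+1)) -
      t (- i%:Z) *: col_mx 1%:M (x i).
    rewrite scalerA -lXD.
    have -> : 1 - i.+1%:Z = - i%:Z by rewrite intS opprD addNKr.
    by rewrite -scalerBr opp_col_mx add_col_mx subrr scale_col_mx scaler0.
  by apply: MD; [apply: MZ => //; apply: lX_valuation_ring|apply: MN].
(* Every b is an O-multiple of t^-i for large i, so it is enough that M contains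
   each t^-i (1, y) = t^-i (1, x_i) + (0, t^-i (y - x_i)). *)
exists (Some true), 1, y; split=> //; first exact: oner_neq0.
move=> b _; have [c bc] := laurent_bound b.
have ci : - c <= (absz c)%:Z by rewrite -abszN lez_abs.
set i := absz c in ci.
have bO : t i%:Z * b \in O.
  rewrite -[i%:Z]opprK; apply/lXM_valuation_ring => m mi; apply: bc.
  by apply: lt_le_trans mi _; rewrite lerNl.
have -> : b = (t i%:Z * b) * t (- i%:Z).
  by rewrite mulrAC lXKN mul1r.
rewrite -scalerA; apply: MZ => //.
have -> : col_mx 1%:M y = col_mx 1%:M (x i) + col_mx 0 (y - x i).
  by rewrite add_col_mx addr0 addrC subrK.
rewrite scalerDr; apply: MD; first exact: Mx.
by rewrite scale_col_mx scaler0; apply: My.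
Qed.

(** The matrix has first column (a, u), the vector that splits off the first
    coordinate, and g' in the remaining diagonal block. *)
Lemma std_step n (M : set 'cV[A]_(1 + n)) (g' : 'M_n) c' :
    is_submodule M -> g' \in unitmx ->
    [set w : 'cV_n | M (col_mx 0 w)] = act g' (std c') ->
  exists2 g, g \in unitmx & exists c, M = act g (std c).
Proof.
move=> Msub g'u M'E; have [M0 MD MZ] := Msub.
have [|s [a [u [a0 Mu Ms]]]] := @pivot n M Msub.
  by rewrite M'E; apply: act_complete => //; apply: std_complete.
have gu : block_mx a%:M 0 u g' \in unitmx.
  rewrite unitmxE det_lblock unitrM -!unitmxE g'u.
  by rewrite unitmxE det_scalar1 unitfE a0.
exists (block_mx a%:M 0 u g') => //; exists (type_cons s c').
have gE b (w : 'cV_n) : block_mx a%:M 0 u g' *m col_mx b%:M w =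
    b *: col_mx a%:M u + col_mx 0 (g' *m w).
  rewrite mul_block_col mul0mx addr0 scale_col_mx add_col_mx addr0.
  by rewrite mul_mx_scalar mul_mx_scalar.
have colE (v : 'cV[A]_(1 + n)) : v = col_mx (usubmx v 0 0)%:M (dsubmx v).
  by rewrite -mx11_scalar vsubmxK.
apply/seteqP; split=> v.
  rewrite (colE v); set x := usubmx v 0 0; set w := dsubmx v => Mv.
  have sb := Ms _ _ Mv.
  have : M (col_mx 0 (w - (x / a) *: u)).
    rewrite -[0 : 'M_1](subrr x%:M) -add_col_mx -opp_col_mx; apply: MD => //.
    have -> : col_mx x%:M (x / a *: u) = (x / a) *: col_mx a%:M u.
      by rewrite scale_col_mx scale_scalar_mx divfK.
    rewrite -scaleN1r; apply: MZ; last exact: Mu.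
    by rewrite rpredN rpred1.
  rewrite -[M _]/([set w : 'cV_n | M (col_mx 0 w)] _) M'E => -[w' cw' w'E].
  exists (col_mx (x / a)%:M w'); first exact/std_cons.
  rewrite gE w'E scale_col_mx scale_scalar_mx divfK// add_col_mx addr0.
  by rewrite addrC subrK.
move=> [z]; rewrite (colE z) => /std_cons[sb cw] <-; rewrite gE.
apply: MD; first exact: Mu.
rewrite -[M _]/([set w : 'cV_n | M (col_mx 0 w)] _) M'E.
by exists (dsubmx z).
Qed.

Lemma submodule_std n (M : set 'cV[A]_n) : is_submodule M ->
  exists2 g, g \in unitmx & exists c, M = act g (std c).
Proof.
elim: n M => [|n IHn] M Msub.
  have [M0 _ _] := Msub; exists 1%:M; first exact: unitmx1.
  exists (fun=> None); apply/seteqP; split=> v _.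
    by exists 0; [case|rewrite !flatmx0].
  by rewrite flatmx0 -[X in M X](flatmx0 0).
have [M0 MD MZ] := Msub.
have [|g' g'u [c' M'E]] := IHn [set w : 'cV[A]_n | M (col_mx (0 : 'cV_1) w)].
  split=> [|u v Mu Mv|a u aO Mu]; rewrite /mkset.
  - by rewrite col_mx0.
  - by rewrite -[0]addr0 -add_col_mx; apply: MD.
  - by rewrite -(scaler0 _ a) -scale_col_mx; apply: MZ.
exact: (@std_step n M g' c').
Qed.

(** * Counting orbits *)

Lemma orbit_act n (g : 'M[A]_n) M :
  g \in unitmx -> Defs.orbit (act g M) = Defs.orbit M.
Proof.
have actM (h h' : 'M[A]_n) : act h (act h' M) = act (h *m h') M.
  by rewrite /act image_comp; apply: eq_imagel => v _ /=; rewrite mulmxA.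
move=> gu; apply/seteqP; split=> _ [h hu <-].
  by exists (h *m g); rewrite ?actM// /GL/= unitmx_mul hu.
exists (h *m invmx g); last by rewrite actM mulmxKV.
by rewrite /GL/= unitmx_mul hu unitmx_inv.
Qed.

End Submodules.

Theorem theorem1p1 (k : fieldType) (n : nat) : finite_set (orbits k n).
Proof.
apply: (@sub_finite_set _ _
  [set Defs.orbit (@std k n c) | c in [set: {ffun 'I_n -> option bool}]]).
  move=> _ [M Msub <-]; have [g gu [c ->]] := submodule_std Msub.
  exists (finfun c) => //; rewrite orbit_act//; congr Defs.orbit.
  by apply/seteqP; split=> v vc i; have := vc i; rewrite ffunE.
exact/finite_image/finite_finset.
Qed.
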